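(* Let $\{A,B\}$ be a singular pair of real symmetric $m\times m$ matrices. Then $\{A,B\}$ is TWSD-B.
   Context: A pair $\{A,B\}$ is singular if every linear combination $\alpha A+\beta B$ with $\alpha,\beta\in\mathbb{R}$ is a singular matrix. $\mathrm{SL}_m(\mathbb{R})$ is the group of real $m\times m$ matrices with determinant $1$; $\|\cdot\|$ is the Frobenius norm. A set $\{A_1,\dots,A_L\}$ of real symmetric $m\times m$ matrices is TWSD-B if there exist $P_k\in\mathrm{SL}_m(\mathbb{R})$ and diagonal matrices $D_k^{(1)},\dots,D_k^{(L)}\in\mathbb{R}^{m\times m}$ for $k\ge 1$ such that $\lim_{k\to\infty}\sum_{i=1}^L\|P_kA_iP_k^{\mathsf T}-D_k^{(i)}\|^2=0$ and $\|D_k^{(i)}\|$ is bounded uniformly in $i$ and $k$. *)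

(* Defs.v *)
From mathcomp Require Import all_boot all_order all_algebra.
From mathcomp Require Import all_classical all_reals all_analysis.
Import Order.TTheory GRing.Theory Num.Theory.
Import numFieldNormedType.Exports.

Set Implicit Arguments.
Unset Strict Implicit.
Unset Printing Implicit Defensive.

Local Open Scope classical_set_scope.
Local Open Scope ring_scope.

(* MathComp-Analysis equips matrices with the max norm `|_|, hence the
   separate definition. *)
Definition frobenius_norm (R : realType) (m : nat) (A : 'M[R]_m) : R :=
  Num.sqrt (\sum_i \sum_j A i j ^+ 2).

Definition singular_pair (R : realType) (m : nat) (A B : 'M[R]_m) : Prop :=
  forall alpha beta : R, alpha *: A + beta *: B \notin unitmx.

(* A finite set {A_1, ..., A_L} is given by an enumeration. Sequences are
   indexed from 0 rather than from 1. The notion is meant for symmetric A_i. *)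
Definition TWSD_B (R : realType) (m L : nat) (A : L.-tuple 'M[R]_m) : Prop :=
  exists (P : nat -> 'M[R]_m) (D : nat -> 'I_L -> 'M[R]_m),
    [/\ forall k, \det (P k) = 1,
        forall k i, is_diag_mx (D k i),
        (fun k => \sum_(i < L)
           frobenius_norm (P k *m tnth A i *m (P k)^T - D k i) ^+ 2)
          @ \oo --> (0 : R)
      & exists M : R, forall k i, frobenius_norm (D k i) <= M].

(* Main.v *)
Require Import Defs.
From mathcomp Require Import all_boot all_order all_algebra.
From mathcomp Require Import all_classical all_reals all_analysis.
From mathcomp Require Import ring zify.
Import Order.TTheory GRing.Theory Num.Theory.
Import numFieldNormedType.Exports.

(** Both matrices can be contracted to zero along a single sequence in SL_m, so
    that the diagonal matrices may all be taken to be zero.  In the language of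
    invariant theory, a singular pair of quadratic forms lies in the nullcone.

    Singularity of the pencil gives a nonzero polynomial row vector v(s) with
    v(s) (A + s B) = 0.  Let U be the span of the coefficients v_i of v.  From
    v_0 A = 0 and v_(i+1) A = - v_i B one gets U A <= U B, and the last nonzero
    coefficient is killed by B, so dim (U B) < dim U ([pencil_kernel_span]).
    The orthogonal W of U B therefore has dim U + dim W > m, and U is orthogonal
    to W for both forms.  By symmetry of A and B, the flag
    X = U cap W <= Y = U + W again satisfies dim X + dim Y > m and X is
    orthogonal to Y for both forms ([orthogonal_flag]): passing to a flag is
    what allows a single congruence, acting in the same way on both sides.

    In a basis adapted to the flag ([flag_basis]), the Gram matrices of A and B
    vanish on the block X x Y.  Because dim X + dim Y > m, some diagonal
    one-parameter subgroup of SL_m expands X but contracts every block that may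
    be nonzero ([det_contraction], [frobenius_contraction]); its parameter is
    then sent to infinity. *)

Local Open Scope ring_scope.

(** * Singular pencils and isotropic flags *)

(** The determinant is a polynomial in s that vanishes at every natural number,
    while the natural numbers are pairwise distinct reals. *)
Lemma pencil_det_eq0 (R : realType) (m : nat) (A B : 'M[R]_m) :
  singular_pair A B -> \det (map_mx polyC A + 'X *: map_mx polyC B) = 0.
Proof.
move=> sing; set p := \det _.
pose rs := [seq (i%:R : R) | i <- iota 0 (size p)].
apply: (@roots_geq_poly_eq0 _ p rs); last by rewrite size_map size_iota.
  apply/allP => _ /mapP[i _ ->]; rewrite /root.
  rewrite -[_.[_]]/(horner_eval _ _) -det_map_mx.
  have := sing 1 i%:R; rewrite unitmxE unitfE negbK scale1r.
  congr (\det _ == 0); apply/matrixP => j k.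
  by rewrite !mxE /= /horner_eval !hornerE.
by rewrite map_inj_uniq ?iota_uniq //; apply: mulrIn; rewrite oner_eq0.
Qed.

(** U is spanned by the coefficients of a polynomial vector in the kernel of the
    pencil: comparing powers of s sends each coefficient, under A, to a multiple
    of the image of the previous one under B, and the rank of U drops under B
    because the last coefficient is in the kernel of B. *)
Lemma pencil_kernel_span {F : fieldType} {m : nat} (A B : 'M[F]_m) :
  \det (map_mx polyC A + 'X *: map_mx polyC B) = 0 ->
  exists n, exists2 U : 'M[F]_(n, m),
    (U *m A <= U *m B)%MS & (\rank (U *m B) < \rank U)%N.
Proof.
move/eqP/det0P => [v v_neq0 vM].
(* The coefficients of v, also defined (and zero) beyond its degree. *)
pose c i : 'rV[F]_m := \row_j (v 0 j)`_i.
have mulc i (M : 'M[F]_m) k : (c i *m M) 0 k = ((v *m map_mx polyC M) 0 k)`_i.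
  rewrite !mxE coef_sum; apply: eq_bigr => j _.
  by rewrite !mxE coefMC.
have vAX k : (v *m map_mx polyC A) 0 k = - ('X * (v *m map_mx polyC B) 0 k).
  apply/eqP; rewrite -addr_eq0; apply/eqP.
  by move/matrixP/(_ 0 k): vM; rewrite mulmxDr -scalemxAr !mxE.
have c0A : c 0%N *m A = 0.
  by apply/rowP => k; rewrite mulc vAX coefN coefXM /= oppr0 mxE.
have cSA i : c i.+1 *m A = - (c i *m B).
  by apply/rowP => k; rewrite mulc vAX coefN coefXM /= [RHS]mxE mulc.
pose n := (\max_j size (v 0%R j))%N.
have size_v j : (size (v 0%R j) <= n)%N.
  exact: (leq_bigmax (F := fun j => size (v 0 j))).
have c_big i : (n <= i)%N -> c i = 0.
  move=> n_le; apply/rowP => j; rewrite !mxE nth_default //.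
  exact: leq_trans (size_v j) n_le.
have /rV0Pn[j0 v_j0] := v_neq0.
have n_gt0 : (0 < n)%N by apply: leq_trans (size_v j0); rewrite size_poly_gt0.
have [j1 n_j1] : {j1 | n = size (v 0 j1)}.
  by apply: (bigop.eq_bigmax (fun j => size (v 0 j)));
    apply/card_gt0P; exists j0.
have c_last : c n.-1 != 0.
  apply/rV0Pn; exists j1; rewrite mxE n_j1 -lead_coefE lead_coef_eq0.
  by rewrite -size_poly_gt0 -n_j1.
pose U : 'M[F]_(n, m) := \matrix_(i < n) c i.
have cU i : (c i <= U)%MS.
  have [i_lt|/c_big->] := ltnP i n; last exact: sub0mx.
  by rewrite -[c i](rowK (fun i : 'I_n => c i) (Ordinal i_lt)) row_sub.
exists n, U.
  apply/row_subP => i; rewrite row_mul rowK.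
  case: (i : nat) => [|k]; first by rewrite c0A sub0mx.
  by rewrite cSA eqmx_opp submxMr.
have cB0 : c n.-1 *m B = 0.
  by apply/oppr_inj; rewrite -cSA prednK // c_big // mul0mx oppr0.
have cap_gt0 : (0 < \rank (U :&: kermx B))%N.
  apply: leq_trans (mxrankS (_ : (c n.-1 <= _)%MS)).
    by rewrite rank_rV c_last.
  by rewrite sub_capmx cU; apply/sub_kermxP.
by rewrite -(mxrank_mul_ker U B) -[X in (X < _)%N]addn0 ltn_add2l.
Qed.

(** Any u in U and w in W are orthogonal for both forms.  A vector of U cap W is
    thus orthogonal to W as an element of U, and to U as an element of W; and
    dim (U cap W) + dim (U + W) = dim U + dim W. *)
Lemma orthogonal_flag {F : fieldType} {m n : nat} (A B : 'M[F]_m)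
    (U : 'M[F]_(n, m)) :
    A^T = A -> B^T = B ->
    (U *m A <= U *m B)%MS -> (\rank (U *m B) < \rank U)%N ->
  exists X Y : 'M[F]_m,
    [/\ (X <= Y)%MS, (m < \rank X + \rank Y)%N,
        X *m A *m Y^T = 0 & X *m B *m Y^T = 0].
Proof.
move=> symA symB UAB rankUB; have [W rankW WBU] : exists2 W : 'M[F]_m,
    \rank W = (m - \rank (U *m B))%N & W *m B *m U^T = 0.
  exists (kermx (B *m U^T)); last by rewrite -mulmxA mulmx_ker.
  by rewrite mxrank_ker -mxrank_tr trmx_mul trmxK symB.
have UBW : U *m B *m W^T = 0.
  by apply: trmx_inj; rewrite !trmx_mul trmxK symB trmx0 mulmxA WBU.
have UAW : U *m A *m W^T = 0.
  by case/submxP: UAB => D ->; rewrite -mulmxA UBW mulmx0.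
have WAU : W *m A *m U^T = 0.
  by apply: trmx_inj; rewrite !trmx_mul trmxK symA trmx0 mulmxA UAW.
have ortho (C : 'M[F]_m) : W *m C *m U^T = 0 -> U *m C *m W^T = 0 ->
    (U :&: W)%MS *m C *m (U + W)%MS^T = 0.
  move=> WU UW; have /sub_addsmxP[[D1 D2] /= ->] := submx_refl (U + W)%MS.
  rewrite linearD /= !trmx_mul mulmxDr !mulmxA.
  have -> : (U :&: W)%MS *m C *m U^T = 0.
    have /submxP[E ->] := capmxSr U W.
    by rewrite -!(mulmxA E) WU mulmx0.
  have -> : (U :&: W)%MS *m C *m W^T = 0.
    have /submxP[E ->] := capmxSl U W.
    by rewrite -!(mulmxA E) UW mulmx0.
  by rewrite !mul0mx addr0.
exists (U :&: W)%MS, (U + W)%MS; split; try exact: ortho.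
  exact: submx_trans (capmxSl _ _) (addsmxSl _ _).
rewrite addnC mxrank_sum_cap rankW.
have := rank_leq_col (U *m B); lia.
Qed.

(** * Unimodular bases adapted to a flag *)

Lemma scale_row_det1 {F : fieldType} {m : nat} (Q : 'M[F]_m) :
  \det Q != 0 -> exists d : 'rV[F]_m, \det (diag_mx d *m Q) = 1.
Proof.
case: m Q => [|m] Q detQ; first by exists 0; rewrite det_mx00.
exists (\row_j (if j == 0 then (\det Q)^-1 else 1)).
rewrite det_mulmx det_diag big_ord_recl mxE eqxx big1 => [|i _].
  by rewrite mulr1 mulVf.
by rewrite mxE.
Qed.

(** Concatenate bases of X, of a complement of X in Y and of a complement of Y,
    and rescale the first vector: this does not move the flag. *)
Lemma flag_basis {F : fieldType} {m : nat} (X Y : 'M[F]_m) :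
    (X <= Y)%MS ->
  exists Q : 'M[F]_m, [/\ \det Q = 1,
    forall i : 'I_m, (i < \rank X)%N -> (row i Q <= X)%MS &
    forall i : 'I_m, (i < \rank Y)%N -> (row i Q <= Y)%MS].
Proof.
move=> XY.
pose M := col_mx (col_mx (row_base X) (row_base (Y :\: X)%MS))
  (row_base Y^C%MS).
have rankY : (\rank X + \rank (Y :\: X)%MS)%N = \rank Y.
  by rewrite -(mxrank_cap_compl Y X) (capmx_idPr XY).
have dims : m = (\rank X + \rank (Y :\: X)%MS + \rank Y^C%MS)%N.
  by rewrite rankY mxrank_compl subnKC // rank_leq_col.
have fullM : row_full M.
  have colS p q (C : 'M[F]_(p, m)) (D : 'M[F]_(q, m)) :
      (C <= col_mx C D)%MS /\ (D <= col_mx C D)%MS.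
    by split; rewrite -addsmxE ?addsmxSl ?addsmxSr.
  have [topM botM] := colS _ _ (col_mx (row_base X) (row_base (Y :\: X)%MS))
    (row_base Y^C%MS).
  have [XM YXM] := colS _ _ (row_base X) (row_base (Y :\: X)%MS).
  rewrite -sub1mx; apply: submx_trans (submx_full _ (addsmx_compl_full Y)) _.
  rewrite addsmx_sub.
  have rbS (C : 'M[F]_m) : (C <= row_base C)%MS by rewrite eq_row_base.
  rewrite (submx_trans (rbS _) botM) andbT -(addsmx_diff_cap_eq Y X) addsmx_sub.
  rewrite (submx_trans (rbS _) (submx_trans YXM topM)) /=.
  apply: submx_trans (capmxSr Y X) _.
  exact: submx_trans (rbS _) (submx_trans XM topM).
pose Q0 : 'M[F]_m := rowsub (cast_ord dims) M.
have rowQ0 (i : 'I_m) : ((i < \rank X)%N -> (row i Q0 <= X)%MS) /\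
    ((i < \rank Y)%N -> (row i Q0 <= Y)%MS).
  rewrite row_rowsub /M; have vi : cast_ord dims i = i :> nat by [].
  (* Rows of the last block have index at least dim Y. *)
  case: (split_ordP (cast_ord dims i)) vi => k ->; last first.
    by rewrite /= => <-; rewrite -rankY -addnA; split; lia.
  rewrite rowKu; case: (split_ordP k) => l -> /= <-; last first.
    rewrite rowKd; split; first by lia.
    rewrite (submx_trans (row_sub _ _)) // eq_row_base.
    by rewrite diffmxSl.
  have lX : (row l (row_base X) <= X)%MS.
    by rewrite (submx_trans (row_sub _ _)) // eq_row_base.
  by rewrite rowKu; split=> // _; apply: submx_trans lX XY.
have detQ0 : \det Q0 != 0.
  rewrite -unitfE -unitmxE -row_full_unit -sub1mx.
  apply: submx_trans (_ : (M <= Q0)%MS); first by rewrite sub1mx.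
  apply/row_subP => k; rewrite -[k](cast_ordKV dims) -row_rowsub.
  exact: row_sub.
have [d detQ] := scale_row_det1 Q0 detQ0.
have rowQ i : row i (diag_mx d *m Q0) = d 0 i *: row i Q0.
  by rewrite row_mul row_diag_mx -scalemxAl -rowE.
exists (diag_mx d *m Q0); split=> // i i_lt; rewrite rowQ scalemx_sub //.
  by have [+ _] := rowQ0 i; apply.
by have [_ +] := rowQ0 i; apply.
Qed.

(** * The contracting one-parameter subgroup *)

(** The exponents a = m - x, b = m - x - y and c = - y of the blocks cut out by
    a flag of dimensions x <= y satisfy x a + (y - x) b + (m - y) c = 0, which
    is determinant one, and a + c = b.  When x + y > m, b is negative, and so
    is the sum of the exponents of every pair of blocks other than (a, a),
    (a, b) and (b, a), those that pair X with Y. *)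
Definition weight (m x y i : nat) : int :=
  if (i < x)%N then m%:Z - x%:Z
  else if (i < y)%N then m%:Z - x%:Z - y%:Z else - y%:Z.

Definition contraction {F : fieldType} (m x y : nat) (t : F) : 'M[F]_m :=
  diag_mx (\row_i t ^ weight m x y i).

Lemma sum_weight (m x y : nat) :
  (x <= y)%N -> (y <= m)%N -> \sum_(i < m) weight m x y i = 0.
Proof.
move=> x_le_y y_le_m.
have cut n (a : int) : (n <= m)%N ->
    \sum_(i < m) (if (i < n)%N then a else 0) = a * n%:Z.
  move=> n_le; rewrite -big_mkcond -(big_ord_widen m (fun=> a)) //=.
  by rewrite sumr_const card_ord -mulr_natr natz.
(* Abel summation: the sum becomes one term for each jump of the weights. *)
have weightE i : weight m x y i = - y%:Z + (if (i < y)%N then m%:Z - x%:Z else 0)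
    + (if (i < x)%N then y%:Z else 0).
  by rewrite /weight; case: (ltnP i x) => ?; case: (ltnP i y) => ?; lia.
under eq_bigr do rewrite weightE.
rewrite !big_split /= !cut //; last exact: leq_trans y_le_m.
by rewrite sumr_const card_ord -mulr_natr natz; ring.
Qed.

Lemma det_contraction {F : fieldType} (m x y : nat) (t : F) :
  (x <= y)%N -> (y <= m)%N -> t != 0 -> \det (contraction m x y t) = 1.
Proof.
move=> x_le_y y_le_m t_neq0; rewrite det_diag.
rewrite (eq_bigr (fun i : 'I_m => t ^ weight m x y i)) => [|i _]; last first.
  by rewrite mxE.
rewrite -[RHS](expr0z t) -(sum_weight _ _ _ x_le_y y_le_m).
by elim/big_rec2: _ => [|i a z _ ->]; rewrite ?expr0z // expfzDr.
Qed.

(** Every nonzero entry of G is multiplied by t to a negative integer power. *)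
Lemma frobenius_contraction {R : realType} (m x y : nat) (G : 'M[R]_m) (t : R) :
    (x <= y)%N -> (y <= m)%N -> (m < x + y)%N -> G^T = G ->
    (forall i j : 'I_m, (i < x)%N -> (j < y)%N -> G i j = 0) -> 1 <= t ->
  frobenius_norm (contraction m x y t *m G *m (contraction m x y t)^T) ^+ 2 <=
    t^-1 * frobenius_norm G ^+ 2.
Proof.
move=> x_le_y y_le_m m_lt symG G0 t_ge1; have t_gt0 : 0 < t by apply: lt_le_trans t_ge1.
have sq_ge0 (H : 'M[R]_m) : 0 <= \sum_i \sum_j H i j ^+ 2.
  by do 2![apply: sumr_ge0 => ? _]; apply: sqr_ge0.
rewrite /frobenius_norm !sqr_sqrtr // mulr_sumr; apply: ler_sum => i _.
rewrite mulr_sumr; apply: ler_sum => j _.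
rewrite tr_diag_mx mul_mx_diag mul_diag_mx !mxE mulrAC -expfzDr ?gt_eqF //.
have [->|Gij] := eqVneq (G i j) 0; first by rewrite mulr0 expr0n /= mulr0.
have w_le : weight m x y i + weight m x y j <= -1.
  have: ~~ ((i < x) && (j < y))%N.
    by apply: contra_neqN Gij => /andP[]; apply: G0.
  have: ~~ ((j < x) && (i < y))%N.
    by apply: contra_neqN Gij => /andP[? ?]; rewrite -symG mxE G0.
  rewrite /weight; case: (ltnP i x) => ?; case: (ltnP i y) => ?;
    by case: (ltnP j x) => ?; case: (ltnP j y) => ?; lia.
rewrite exprMn ler_wpM2r ?sqr_ge0 //.
have s_le : t ^ (weight m x y i + weight m x y j) <= t^-1.
  exact: ler_weXz2l t_ge1 _ _ w_le.
have s_ge0 : 0 <= t ^ (weight m x y i + weight m x y j) by apply/exprz_ge0/ltW.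
have tV_le1 : t^-1 <= 1 by rewrite invf_le1.
(* The entries get squared, but one factor 1/t is enough for convergence. *)
rewrite expr2 -[leRHS]mulr1 ler_pM //; exact: le_trans tV_le1.
Qed.

(** * Singular pairs are contracted to zero *)

Theorem theorem3p9 (R : realType) (m : nat) (A B : 'M[R]_m)
    (symA : A^T = A) (symB : B^T = B) (sing : singular_pair A B) :
  TWSD_B [tuple A; B].
Proof.
have [n [U UAB rankUB]] := pencil_kernel_span _ _ (pencil_det_eq0 _ _ _ _ sing).
have [X [Y [XY m_lt XAY XBY]]] := orthogonal_flag _ _ _ symA symB UAB rankUB.
have [Q [detQ QX QY]] := flag_basis _ _ XY.
have xy := mxrankS XY; have ym := rank_leq_col Y.
pose T k := contraction m (\rank X) (\rank Y) (k.+1%:R : R).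
pose bound i := frobenius_norm (Q *m tnth [tuple A; B] i *m Q^T) ^+ 2.
have shrink k i : frobenius_norm
    (T k *m Q *m tnth [tuple A; B] i *m (T k *m Q)^T - 0) ^+ 2
      <= k.+1%:R^-1 * bound i.
  have [symC XCY] : let C := tnth [tuple A; B] i in
      C^T = C /\ X *m C *m Y^T = 0.
    by rewrite (tnth_nth 0); case: i => [[|[]]].
  rewrite subr0 trmx_mul !mulmxA -[T k *m Q *m _]mulmxA.
  rewrite -[T k *m _ *m Q^T]mulmxA.
  apply: frobenius_contraction => //; last by rewrite ler1n.
    by rewrite !trmx_mul trmxK symC mulmxA.
  move=> a b /QX/submxP[D1 rowa] /QY/submxP[D2 rowb].
  have -> : (Q *m tnth [tuple A; B] i *m Q^T) a b =
      (row a Q *m tnth [tuple A; B] i *m (row b Q)^T) 0 0.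
    by rewrite -row_mul !mxE; apply: eq_bigr => c _; rewrite !mxE.
  rewrite rowa rowb trmx_mul mulmxA -!(mulmxA D1) XCY mul0mx mulmx0.
  by rewrite mxE.
exists (fun k => T k *m Q), (fun _ _ => 0); split.
- by move=> k; rewrite det_mulmx detQ mulr1 det_contraction ?pnatr_eq0.
- by move=> k i; apply/is_diag_mxP => a b _; rewrite mxE.
- apply: (squeeze_cvgr (f := fun=> 0)
    (h := fun k => harmonic k * \sum_i bound i)).
  + near=> k; apply/andP; split.
      by apply: sumr_ge0 => i _; apply: sqr_ge0.
    by rewrite mulr_sumr; apply: ler_sum.
  + exact: cvg_cst.
  + have := cvgM (@cvg_harmonic R) (cvg_cst (\sum_i bound i)).
    by rewrite mul0r; apply.
- by exists (frobenius_norm (0 : 'M[R]_m)).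
Unshelve. all: by end_near.
Qed.
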